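(* Assume that $u^0\in\mathcal{C}_h$ and $0<u^0_{i,j}<1$ for all $i,j$. Let $\tau>0$ be any time step size and let $u^1,u^2,\dots\in\mathcal{C}_h$ (with values in $(0,1)$) be generated by the convex splitting scheme $$\frac{u^{n+1}-u^n}{\tau}-\epsilon^2\Delta_hu^{n+1}+\log(u^{n+1})-\log(1-u^{n+1})+\theta(1-2u^n)=0,\qquad n=0,1,2,\dots$$ Then the discrete energy is dissipated with the time steps, i.e. for every $n\ge0$, $$E_h(u^{n+1})\le E_h(u^n).$$
   Context: Fix $L>0$, a positive integer $N$, $h=L/N$, and parameters $\epsilon>0$, $\theta>2$. $\mathcal{C}_h$ is the real vector space of doubly $N$-periodic grid functions $\phi=(\phi_{i,j})_{i,j\in\mathbb{Z}}$, $\phi_{i,j}=\phi_{i+\lambda N,j+\mu N}$ for all $i,j,\lambda,\mu\in\mathbb{Z}$, with inner product $\langle\phi,\psi\rangle_h=h^2\sum_{i,j=1}^N\phi_{i,j}\psi_{i,j}$. The discrete Laplacian is $(\Delta_h\phi)_{i,j}=\frac1{h^2}(\phi_{i+1,j}+\phi_{i-1,j}+\phi_{i,j+1}+\phi_{i,j-1}-4\phi_{i,j})$, and the discrete gradient norm is given by $\|\nabla_h\phi\|_h^2=h^2\sum_{i,j=1}^N\left[\left(\frac{\phi_{i+1,j}-\phi_{i,j}}{h}\right)^2+\left(\frac{\phi_{i,j+1}-\phi_{i,j}}{h}\right)^2\right]$. Functions such as $\log$ are applied pointwise, and scalars denote constant grid functions. The discrete energy is $E_h(u)=\langle F(u),1\rangle_h+\frac{\epsilon^2}{2}\|\nabla_hu\|_h^2$,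 where $F(u)=u\log(u)+(1-u)\log(1-u)+\theta(u-u^2)$. For each $n$, the scheme has a unique solution $u^{n+1}$ with values in $(0,1)$. *)

(* Defs.v *)
From HB Require Import structures.
From mathcomp Require Import all_boot all_order all_algebra.
From mathcomp Require Import all_classical all_reals all_analysis.
Set Implicit Arguments.
Unset Strict Implicit.
Unset Printing Implicit Defensive.
Import Order.TTheory GRing.Theory Num.Theory.
Local Open Scope ring_scope.

Section Grid.
Variable R : realType.

(* Grid functions on Z^2, before any periodicity is imposed. *)
Definition grid := int -> int -> R.

Definition doubly_periodic (N : nat) (phi : grid) : Prop :=
  forall i j lambda mu : int,
    phi i j = phi (i + lambda * N%:Z) (j + mu * N%:Z).

Variables (N : nat) (h : R).

Definition grid_inner (phi psi : grid) : R :=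
  h ^+ 2 * \sum_(1 <= i < N.+1) \sum_(1 <= j < N.+1)
             phi i%:Z j%:Z * psi i%:Z j%:Z.

Definition grid_laplacian (phi : grid) : grid := fun i j =>
  1 / h ^+ 2 *
  (phi (i + 1) j + phi (i - 1) j + phi i (j + 1) + phi i (j - 1)
   - 4 * phi i j).

Definition grid_grad_norm_sq (phi : grid) : R :=
  h ^+ 2 * \sum_(1 <= i < N.+1) \sum_(1 <= j < N.+1)
    (((phi (i%:Z + 1) j%:Z - phi i%:Z j%:Z) / h) ^+ 2
     + ((phi i%:Z (j%:Z + 1) - phi i%:Z j%:Z) / h) ^+ 2).

(* Meaningful for 0 < x < 1 only: [ln] is total, with value 0 on
   nonpositive arguments. *)
Definition energy_density (theta x : R) : R :=
  x * ln x + (1 - x) * ln (1 - x) + theta * (x - x ^+ 2).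

Definition discrete_energy (epsilon theta : R) (u : grid) : R :=
  grid_inner (fun i j => energy_density theta (u i j)) (fun _ _ => 1)
  + epsilon ^+ 2 / 2 * grid_grad_norm_sq u.

Definition convex_splitting_step (epsilon theta tau : R) (u v : grid) : Prop :=
  forall i j : int,
    (v i j - u i j) / tau - epsilon ^+ 2 * grid_laplacian v i j
    + ln (v i j) - ln (1 - v i j) + theta * (1 - 2 * u i j) = 0.

End Grid.

(* Main.v *)
Require Import Defs.
From HB Require Import structures.
From mathcomp Require Import all_boot all_order all_algebra.
From mathcomp Require Import all_classical all_reals all_analysis.
From mathcomp Require Import ring lra.
Set Implicit Arguments.
Unset Strict Implicit.
Unset Printing Implicit Defensive.
Import Order.TTheory GRing.Theory Num.Theory.
Local Open Scope ring_scope.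

(** Write [u] for the old state, [v] for the new one and [w = v - u].  The
    energy is a convex part (the entropy and the gradient term) plus a concave
    part (the term in [theta]).  A convex function lies above its tangents, so
    its increment from [u] to [v] is at most its derivative at the new point
    [v] applied to [w]; a concave function lies below its tangents, so its
    increment is at most its derivative at the old point [u] applied to [w].
    These are exactly the points at which the scheme evaluates the two
    derivatives ([entropy_increment_le], [concave_increment_le],
    [half_sqr_increment_le]).

    The derivative of the gradient term along [w] is the sum of the products
    of the difference quotients of [v] and [w], and summation by parts over a
    period ([grid_green]) turns it into the sum of [- w * grid_laplacian v].
    Adding everything up, the increment of the energy is at most the sum over
    the grid of [w] times the left-hand side of the scheme without its time
    difference quotient, which the scheme says is the sum of [- w ^+ 2 / tau].
    This is nonpositive, whatever the size of [tau]. *)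

Section EnergyDissipation.
Variable R : realType.
Implicit Types (N : nat) (x y : R) (u v w : grid R).

(** Since [ln t <= t - 1], the two errors [x * ln (y / x)] and
    [(1 - x) * ln ((1 - y) / (1 - x))] of the linearization are at most
    [y - x] and [x - y], and these two bounds cancel. *)
Lemma entropy_increment_le x y : 0 < x < 1 -> 0 < y < 1 ->
  (y * ln y + (1 - y) * ln (1 - y)) - (x * ln x + (1 - x) * ln (1 - x))
  <= (y - x) * (ln y - ln (1 - y)).
Proof.
have mul_ln_le (a b : R) : 0 < a -> 0 < b -> a * (ln b - ln a) <= b - a.
  move=> a0 b0.
  have ab0 : 0 < b / a by rewrite divr_gt0.
  have ln_ba : ln (b / a) = ln b - ln a by rewrite ln_div ?posrE.
  have le_ba : ln b - ln a <= b / a - 1.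
    by rewrite -ln_ba -[X in ln X](subrKC 1) le_ln1Dx // ltrBrDl subrr.
  have -> : b - a = a * (b / a - 1) by field; rewrite gt_eqF.
  exact: ler_wpM2l (ltW a0) _ _ le_ba.
move=> /andP[x0 x1] /andP[y0 y1].
have e1 := mul_ln_le x y x0 y0.
have e2 : (1 - x) * (ln (1 - y) - ln (1 - x)) <= (1 - y) - (1 - x).
  by apply: mul_ln_le; rewrite subr_gt0.
lra.
Qed.

Lemma concave_increment_le theta x y : 0 <= theta ->
  theta * (y - y ^+ 2) - theta * (x - x ^+ 2)
  <= (y - x) * (theta * (1 - 2 * x)).
Proof.
move=> theta0; rewrite -subr_ge0.
rewrite [X in 0 <= X](_ : _ = theta * (y - x) ^+ 2); last by ring.
by rewrite mulr_ge0 ?sqr_ge0.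
Qed.

Lemma half_sqr_increment_le x y : (y ^+ 2 - x ^+ 2) / 2 <= y * (y - x).
Proof. by have := sqr_ge0 (y - x); rewrite !expr2; lra. Qed.

Lemma periodic_diff_sum N (p : int -> R) :
    (forall i, p i = p (i + N%:Z)) ->
  \sum_(1 <= i < N.+1) (p (i%:Z + 1) - p i%:Z) = 0.
Proof.
move=> p_per.
rewrite (eq_bigr (fun i => p i.+1%:Z - p i%:Z)); last first.
  by move=> i _; rewrite -addn1 PoszD.
by rewrite (telescope_sumr (fun i => p i%:Z)) // -add1n PoszD -p_per subrr.
Qed.

(** The one-dimensional summation by parts: the summand is the forward
    difference of [i |-> w i * (v i - v (i - 1))]. *)
Lemma periodic_sum_by_parts N (v w : int -> R) :
    (forall i, v i = v (i + N%:Z)) -> (forall i, w i = w (i + N%:Z)) ->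
  \sum_(1 <= i < N.+1)
    ((v (i%:Z + 1) - v i%:Z) * (w (i%:Z + 1) - w i%:Z)
     + w i%:Z * (v (i%:Z + 1) + v (i%:Z - 1) - 2 * v i%:Z)) = 0.
Proof.
move=> v_per w_per.
rewrite -[RHS](@periodic_diff_sum N (fun i => w i * (v i - v (i - 1)))); last first.
  by move=> i; rewrite -w_per -v_per addrAC -v_per.
by apply: eq_bigr => i _; rewrite addrK; ring.
Qed.

Lemma doubly_periodic_row N u i j :
  doubly_periodic N u -> u i j = u (i + N%:Z) j.
Proof. by move=> /(_ i j 1 0); rewrite mul1r mul0r addr0. Qed.

Lemma doubly_periodic_col N u i j :
  doubly_periodic N u -> u i j = u i (j + N%:Z).
Proof. by move=> /(_ i j 0 1); rewrite mul1r mul0r addr0. Qed.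

(** Discrete Green formula on the torus: there is no boundary term, and the
    two directions are summed by parts separately. *)
Lemma grid_green N (h : R) v w :
    h != 0 -> doubly_periodic N v -> doubly_periodic N w ->
  \sum_(1 <= i < N.+1) \sum_(1 <= j < N.+1)
    ((v (i%:Z + 1) j%:Z - v i%:Z j%:Z) / h
       * ((w (i%:Z + 1) j%:Z - w i%:Z j%:Z) / h)
     + (v i%:Z (j%:Z + 1) - v i%:Z j%:Z) / h
       * ((w i%:Z (j%:Z + 1) - w i%:Z j%:Z) / h)
     + w i%:Z j%:Z * grid_laplacian h v i%:Z j%:Z) = 0.
Proof.
move=> h0 v_per w_per.
pose G1 (i j : int) := (v (i + 1) j - v i j) * (w (i + 1) j - w i j)
  + w i j * (v (i + 1) j + v (i - 1) j - 2 * v i j).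
pose G2 (i j : int) := (v i (j + 1) - v i j) * (w i (j + 1) - w i j)
  + w i j * (v i (j + 1) + v i (j - 1) - 2 * v i j).
transitivity (h ^- 2 * (\sum_(1 <= j < N.+1) \sum_(1 <= i < N.+1) G1 i j
                      + \sum_(1 <= i < N.+1) \sum_(1 <= j < N.+1) G2 i j)).
  rewrite [X in X + _]exchange_big -big_split big_distrr; apply: eq_bigr => i _.
  rewrite -big_split big_distrr; apply: eq_bigr => j _ /=.
  by rewrite /G1 /G2 /grid_laplacian; field.
rewrite big1 => [|j _]; last first.
  apply: (periodic_sum_by_parts (v := v^~ j%:Z) (w := w^~ j%:Z)) => i;
    exact: doubly_periodic_row.
rewrite big1 ?addr0 ?mulr0 // => i _.
by apply: periodic_sum_by_parts => j; apply: doubly_periodic_col.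
Qed.

Lemma doubly_periodicB N u v :
  doubly_periodic N u -> doubly_periodic N v ->
  doubly_periodic N (fun i j => v i j - u i j).
Proof. by move=> u_per v_per i j k l; rewrite -u_per -v_per. Qed.

Lemma discrete_energyE N (h epsilon theta : R) u :
  discrete_energy N h epsilon theta u =
  h ^+ 2 * \sum_(1 <= i < N.+1) \sum_(1 <= j < N.+1)
    (energy_density theta (u i%:Z j%:Z)
     + epsilon ^+ 2 / 2 *
       (((u (i%:Z + 1) j%:Z - u i%:Z j%:Z) / h) ^+ 2
        + ((u i%:Z (j%:Z + 1) - u i%:Z j%:Z) / h) ^+ 2)).
Proof.
rewrite /discrete_energy /grid_inner /grid_grad_norm_sq mulrCA -mulrDr.
congr (_ * _); rewrite big_distrr -big_split; apply: eq_bigr => i _ /=.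
rewrite big_distrr -big_split; apply: eq_bigr => j _ /=.
by rewrite mulr1.
Qed.

Lemma convex_splitting_step_energy_le N (h epsilon theta tau : R) u v :
    h != 0 -> 0 <= theta -> 0 <= tau ->
    doubly_periodic N u -> doubly_periodic N v ->
    (forall i j, 0 < u i j < 1) -> (forall i j, 0 < v i j < 1) ->
    convex_splitting_step h epsilon theta tau u v ->
  discrete_energy N h epsilon theta v <= discrete_energy N h epsilon theta u.
Proof.
move=> h0 theta0 tau0 u_per v_per u01 v01 step.
rewrite !discrete_energyE ler_wpM2l ?sqr_ge0 // -subr_le0.
have green := grid_green h0 v_per (doubly_periodicB u_per v_per).
(* Subtract a multiple of the vanishing Green sum, so that the inequality
   holds at every grid point. *)
rewrite -[leLHS]subr0 -[X in _ - X <= _](mulr0 (epsilon ^+ 2)).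
rewrite -[X in _ - _ * X <= _]green big_distrr -!sumrB; apply: sumr_le0 => i _ /=.
rewrite big_distrr -!sumrB; apply: sumr_le0 => j _ /=.
have entropy := entropy_increment_le (u01 i j) (v01 i j).
have concave := concave_increment_le (u i j) (v i j) theta0.
have grad1 := half_sqr_increment_le
  ((u (i%:Z + 1) j - u i j) / h) ((v (i%:Z + 1) j - v i j) / h).
have grad2 := half_sqr_increment_le
  ((u i (j%:Z + 1) - u i j) / h) ((v i (j%:Z + 1) - v i j) / h).
have grad := ler_wpM2l (sqr_ge0 epsilon) (lerD grad1 grad2).
have time : 0 <= (v i j - u i j) * ((v i j - u i j) / tau).
  by rewrite mulrA -expr2 divr_ge0 ?sqr_ge0.
have eqn := congr1 (fun x => (v i j - u i j) * x) (step i j).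
rewrite /= mulr0 in eqn.
(* Entropy, concave part, gradient and scheme add up to [- time]. *)
rewrite /energy_density; lra.
Qed.

End EnergyDissipation.

Theorem theorem4p2 (R : realType) (L : R) (N : nat) (epsilon theta tau : R)
    (u : nat -> grid R)
    (L_gt0 : 0 < L) (N_gt0 : (0 < N)%N)
    (epsilon_gt0 : 0 < epsilon) (theta_gt2 : 2 < theta) (tau_gt0 : 0 < tau)
    (u_periodic : forall n : nat, doubly_periodic N (u n))
    (u0_range : forall i j : int, 0 < u 0%N i j < 1)
    (u_range : forall (n : nat) (i j : int), 0 < u n.+1 i j < 1)
    (u_scheme : forall n : nat,
       convex_splitting_step (L / N%:R) epsilon theta tau (u n) (u n.+1)) :
  forall n : nat,
    discrete_energy N (L / N%:R) epsilon theta (u n.+1)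
    <= discrete_energy N (L / N%:R) epsilon theta (u n).
Proof.
move=> n; apply: (convex_splitting_step_energy_le (tau := tau)) => //.
- by rewrite mulf_neq0 ?invr_eq0 ?gt_eqF // ltr0n.
- by rewrite (le_trans _ (ltW theta_gt2)).
- exact: ltW.
- by case: n => [|n].
Qed.
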